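(* Let $I\subsetneq P=\Bbbk[x_1,\dots,x_n]$ be a non-zero proper homogeneous ideal with a homogeneous Pommaret basis $H$ for some term order $\prec$, and let $D$ be the Krull dimension of $A=P/I$. Then the restriction of the canonical projection $\pi:P\to A$ to $\Bbbk[x_1,\dots,x_D]$ is a Noether normalisation of $A$. If $\prec$ is the lexicographic or the degree lexicographic order, then it is even a general Noether normalisation.
   Context: $\Bbbk$ is a field. The class of $\mu\in\mathbb{N}_0^n$ is $\mathrm{cls}\,\mu=\min\{j\mid\mu_j\ne0\}$, with $\mathrm{cls}\,0=n$; the Pommaret cone of $\mu$ is $C_P(\mu)=\{\mu+\rho\mid\rho\in\mathbb{N}_0^n,\ \rho_j=0\text{ for all }j>\mathrm{cls}\,\mu\}$. A Pommaret basis of $I$ for $\prec$ is a finite set $H\subset I\setminus\{0\}$ with pairwise distinct leading exponents such that $\mathrm{le}_\prec I=\{\mathrm{le}_\prec f\mid0\ne f\in I\}$ ($\mathrm{le}_\prec f$ the leading exponent of $f$) is the disjoint union of the cones $C_P(\mathrm{le}_\prec h)$, $h\in H$; it is homogeneous if all its elements are. Conventions for orders: in the lexicographic order $x^\mu\prec x^\nu$ iff the last non-vanishing entry of $\mu-\nu$ is negative (so $x_1\prec\dots\prec x_n$); the degree lexicographic order compares first total degrees and then uses the lexicographic order. The restriction $\Bbbk[x_1,\dots,x_D]\to A$ is a Noether normalisation if it is injective and makes $A$ a finitely generated $\Bbbk[x_1,\dots,x_D]$-module. It is a general Noether normalisation if moreover, for every $D<k\le n$, the ideal $I$ contains a polynomial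 of the form $h_k=x_k^{e_k}+\sum_{j=0}^{e_k-1}P_{k,j}x_k^j$ with $P_{k,j}\in\Bbbk[x_1,\dots,x_{k-1}]$ and $\deg P_{k,j}+j\le e_k$ whenever $P_{k,j}\neq0$. *)

(* Defs.v *)
From mathcomp Require Export all_boot all_order all_algebra.
From mathcomp Require Export generic_quotient ring_quotient.
From mathcomp.multinomials Require Export mpoly.

Set Implicit Arguments.
Unset Strict Implicit.
Unset Printing Implicit Defensive.

Import GRing.Theory.

Local Open Scope ring_scope.
Local Open Scope quotient_scope.

(* The variable x_k (1 <= k <= n) is 'X_i for the i : 'I_n with i.+1 = k, so a  *)
(* condition on the index k reads as a condition on i.+1.                       *)

Section TermOrders.
Variable n : nat.
Implicit Types mu nu rho : 'X_{1..n}.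

(* prec is the strict order. *)
Record term_order (prec : rel 'X_{1..n}) : Prop := TermOrder {
  term_order_irr : irreflexive prec;
  term_order_trans : transitive prec;
  term_order_total : forall mu nu, mu != nu -> prec mu nu || prec nu mu;
  term_order_add : forall rho mu nu,
    prec mu nu -> prec (mu + rho)%MM (nu + rho)%MM;
  term_order_min : forall mu, mu != 0%MM -> prec 0%MM mu
}.

Definition lex_lt : rel 'X_{1..n} := fun mu nu =>
  [exists i : 'I_n, (mu i < nu i)%N &&
     [forall j : 'I_n, (i < j)%N ==> (mu j == nu j)]].

Definition deglex_lt : rel 'X_{1..n} := fun mu nu =>
  (mdeg mu < mdeg nu)%N || ((mdeg mu == mdeg nu) && lex_lt mu nu).

(* Numbered from 1; cls 0 = n is the default value of the minimum, which does   *)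
(* not interfere with the other cases since all indices are at most n.          *)
Definition cls mu : nat := \big[minn/n]_(i < n | mu i != 0%N) i.+1.

Definition pommaret_cone mu nu : Prop :=
  exists2 rho : 'X_{1..n}, (forall j : 'I_n, (cls mu < j.+1)%N -> rho j = 0%N)
             & nu = (mu + rho)%MM.

End TermOrders.

(* idealr and prime_idealr are proper ideals given by boolean predicates;       *)
(* classically every proper, resp. prime, ideal is of this form.                *)

Section Polynomials.
Variables (k : fieldType) (n : nat).
Implicit Types (p f : {mpoly k[n]}) (I : idealr {mpoly k[n]}).

(* The prec-largest exponent of f; the junk value at f = 0 is 0. *)
Definition lead_exp (prec : rel 'X_{1..n}) f : 'X_{1..n} :=
  \big[(fun mu nu => if prec mu nu then nu else mu)/0%MM]_(mu <- msupp f) mu.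

Definition lead_exps (prec : rel 'X_{1..n}) I (nu : 'X_{1..n}) : Prop :=
  exists f, [/\ f \in I, f != 0 & lead_exp prec f = nu].

Record pommaret_basis (prec : rel 'X_{1..n}) I (H : seq {mpoly k[n]}) : Prop :=
  PommaretBasis {
  pommaret_sub : forall h, h \in H -> h \in I /\ h != 0;
  pommaret_inj : {in H &, injective (lead_exp prec)};
  pommaret_cover : forall nu, lead_exps prec I nu <->
    exists2 h, h \in H & pommaret_cone (lead_exp prec h) nu;
  pommaret_disjoint : forall h h', h \in H -> h' \in H -> h != h' ->
    forall nu, ~ (pommaret_cone (lead_exp prec h) nu /\
                  pommaret_cone (lead_exp prec h') nu)
}.

Definition homog_ideal I : Prop :=
  forall p, p \in I -> forall d, pihomog mdeg d p \in I.

(* The subring k[x_1, ..., x_D] of k[x_1, ..., x_n]; it is everything if        *)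
(* n <= D.                                                                      *)
Definition first_vars (D : nat) : {pred {mpoly k[n]}} := fun p =>
  all (fun mu : 'X_{1..n} => [forall i : 'I_n, (D < i.+1)%N ==> (mu i == 0%N)])
      (msupp p).

(* For a non-zero ideal, injectivity excludes n <= D.                           *)
Definition noether_normalisation (D : nat) I : Prop :=
  {in first_vars D &, injective \pi_({ideal_quot I})} /\
  exists s : seq {ideal_quot I}, forall a : {ideal_quot I},
    exists c : 'I_(size s) -> {mpoly k[n]},
      (forall j, c j \in first_vars D) /\
      a = \sum_(j < size s) \pi_({ideal_quot I}) (c j) * s`_j.

Definition general_noether_normalisation (D : nat) I : Prop :=
  noether_normalisation D I /\
  forall i : 'I_n, (D < i.+1)%N ->
    exists (e : nat) (P : 'I_e -> {mpoly k[n]}),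
      [/\ forall j, P j \in first_vars i,
          forall j, P j != 0 -> ((msize (P j)).-1 + j <= e)%N
        & 'X_i ^+ e + \sum_(j < e) P j * 'X_i ^+ j \in I].

End Polynomials.

(* p_0 < p_1 < ... < p_d *)
Definition prime_chain (A : comNzRingType) (d : nat)
    (p : 'I_d.+1 -> prime_idealr A) : Prop :=
  forall i j : 'I_d.+1, (i < j)%N ->
    {subset p i <= p j} /\ exists2 a, a \in p j & a \notin p i.

Definition krull_dim (A : comNzRingType) (d : nat) : Prop :=
  (exists p : 'I_d.+1 -> prime_idealr A, prime_chain p) /\
  forall d' (p : 'I_d'.+1 -> prime_idealr A), prime_chain p -> (d' <= d)%N.

(* Main.v *)
(* The leading exponents L of I form a monomial ideal with a finite Pommaret basis.
   Multiplying an element of L by a high power of its last variable x_c forces its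
   cone to have class c, so x_c^N lies in L; hence for some D' the ideal L contains
   a power of x_c for every c > D', but no monomial in x_1, ..., x_D'.  As I is
   homogeneous, the reduction of monomials to normal form takes place in the finite
   set of monomials of a given degree, so it terminates and preserves degrees; the
   normal forms have bounded exponents beyond x_D'.  This makes k[x_1, ..., x_D'] a
   Noether normalisation of A, and D' = dim A follows from two inequalities:
   - a prime chain of length d yields d elements of A that are algebraically
     independent: comparing the growth of t^d monomials in them with the
     number O(t^D') of normal forms of degree O(t) gives d <= D';
   - going up along the primes (x_1, ..., x_i) of k[x_1, ..., x_D'] gives a prime
     chain of length D'.
   For the (degree) lexicographic order, an element of I with leading monomial x_c^N,
   made homogeneous, is the required monic equation of x_c. *)
Require Import Defs.
From HB Require Import structures.
From mathcomp Require boolp classical_sets.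
From mathcomp Require Import ring zify.

Set Implicit Arguments.
Unset Strict Implicit.
Unset Printing Implicit Defensive.

Import GRing.Theory.

Local Open Scope ring_scope.
Local Open Scope quotient_scope.

(** * Ideals as sets, and prime ideals avoiding a multiplicative set *)

Section IdealSets.
Variable A : comNzRingType.
Implicit Types (X Y S : A -> Prop) (a b u : A).

(** Unlike [idealr], this admits the whole ring and sets that are not boolean predicates, so Zorn's
    lemma applies; properness comes from avoiding a set that contains 1. *)
Definition ideal_set X : Prop :=
  [/\ X 0, forall a b, X a -> X b -> X (a + b) & forall a b, X b -> X (a * b)].

(** The ideal X + (u). *)
Definition adjoin X u : A -> Prop := fun a => exists m c, X m /\ a = m + c * u.

Lemma adjoin_ideal X u : ideal_set X -> ideal_set (adjoin X u).
Proof.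
move=> [X0 XD XM]; split.
- by exists 0, 0; rewrite mul0r addr0.
- move=> _ _ [m [c [Xm ->]]] [m' [c' [Xm' ->]]].
  by exists (m + m'), (c + c'); split; [exact: XD | rewrite mulrDl addrACA].
- move=> a _ [m [c [Xm ->]]].
  by exists (a * m), (a * c); split; [exact: XM | rewrite mulrDr mulrA].
Qed.

Lemma adjoin_sub X u a : X a -> adjoin X u a.
Proof. by move=> Xa; exists a, 0; rewrite mul0r addr0. Qed.

Lemma adjoin_gen X u : ideal_set X -> adjoin X u u.
Proof. by case=> X0 _ _; exists 0, 1; rewrite mul1r add0r. Qed.

Lemma maximal_ideal_avoiding X S : ideal_set X -> (forall a, X a -> ~ S a) ->
  exists M, [/\ ideal_set M, forall a, X a -> M a, forall a, M a -> ~ S a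
    & forall Y, ideal_set Y -> (forall a, M a -> Y a) ->
        (forall a, Y a -> ~ S a) -> forall a, Y a -> M a].
Proof.
move=> [X0 XD XM] XS.
(* Adding [X] to every set makes the empty chain harmless. *)
pose P (Z : A -> Prop) :=
  ideal_set (fun a => X a \/ Z a) /\ forall a, Z a -> ~ S a.
have [|Z [[[_ ZD ZM] ZS] Zmax]] := @classical_sets.Zorn_bigcup A P.
  move=> F FP Ftot; split; last by move=> a [Z FZ Za]; have [_] := FP _ FZ; apply.
  split; first by left.
  - move=> a b [Xa|[Z FZ Za]] [Xb|[Z' FZ' Zb]].
    + by left; apply: XD.
    + have [[_ ZD _] _] := FP _ FZ'.
      by have [] := ZD a b (or_introl Xa) (or_intror Zb); [left | right; exists Z'].
    + have [[_ ZD _] _] := FP _ FZ.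
      by have [] := ZD a b (or_intror Za) (or_introl Xb); [left | right; exists Z].
    + have [[_ ZD _] _] := FP _ FZ; have [[_ ZD' _] _] := FP _ FZ'.
      have [sub|sub] := Ftot _ _ FZ FZ'.
      * have [] := ZD' a b (or_intror (sub _ Za)) (or_intror Zb); first by left.
        by right; exists Z'.
      * have [] := ZD a b (or_intror Za) (or_intror (sub _ Zb)); first by left.
        by right; exists Z.
  - move=> a b [Xb|[Z FZ Zb]]; first by left; apply: XM.
    have [[_ _ ZM] _] := FP _ FZ.
    by have [] := ZM a b (or_intror Zb); [left | right; exists Z].
exists (fun a => X a \/ Z a); split.
- by split=> //; left.
- by left.
- by move=> a [/XS|/ZS].
- move=> Y [Y0 YD YM] subY YS a Ya; right.
  have [//|nZa] := boolp.EM (Z a); case: (Zmax Y).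
    split; first by move=> b Zb; apply: subY; right.
    by move=> /(_ a Ya).
  split=> //; split; first by left.
  + move=> b c [Xb|Yb] [Xc|Yc]; right; apply: YD => //; apply: subY; by left.
  + move=> b c [Xc|Yc]; right; apply: YM => //; apply: subY; by left.
Qed.

(** An ideal M maximal among those avoiding S is prime: if u and v are outside M, then M + (u) and M
    + (v) meet S, and the product of the two meeting elements lies in S and in M + (uv), so uv is
    outside M. *)
Lemma prime_avoiding X S : ideal_set X -> S 1 ->
    (forall a b, S a -> S b -> S (a * b)) -> (forall a, X a -> ~ S a) ->
  exists p : prime_idealr A,
    (forall a, X a -> a \in p) /\ (forall a, a \in p -> ~ S a).
Proof.
move=> Xid S1 SM XS.
have [M [Mid XM MS Mmax]] := maximal_ideal_avoiding Xid XS.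
have [M0 MD MM] := Mid.
have meetS u : ~ M u -> exists m c, M m /\ S (m + c * u).
  move=> nMu; apply: boolp.contrapT => none; apply: nMu.
  apply: (Mmax _ (adjoin_ideal u Mid) (@adjoin_sub M u)); last exact: adjoin_gen.
  by move=> _ [m [c [Mm ->]]] Sa; apply: none; exists m, c.
pose pr : A -> bool := fun a => boolp.asbool (M a).
have prE a : (a \in pr) <-> M a by split=> /boolp.asboolP.
have pr_ideal : idealr_closed (pr : {pred A}).
  split; first exact/prE.
    by apply/negP => /prE /MS.
  by move=> a u v /prE Mu /prE Mv; apply/prE/MD => //; apply: MM.
have pr_prime : prime_idealr_closed (pr : {pred A}).
  move=> u v /prE Muv; apply/orP; apply: boolp.contrapT => /orP.
  rewrite negb_or => /andP[nu nv].
  have [m [c [Mm Su]]] := meetS u (fun Mu => negP nu (proj2 (prE u) Mu)).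
  have [m' [c' [Mm' Sv]]] := meetS v (fun Mv => negP nv (proj2 (prE v) Mv)).
  apply: (MS _ _ (SM _ _ Su Sv)).
  have -> : (m + c * u) * (m' + c' * v) = (m' + c' * v) * m + c * u * m' + c * c' * (u * v).
    by ring.
  by apply: (MD); [apply: (MD); exact: MM | exact: MM].
pose p : prime_idealr A := HB.pack_for (prime_idealr A) pr
  (isIdealr.Build A pr pr_ideal) (isPrimeIdealrClosed.Build A pr pr_prime).
by exists p; split=> a; [move/XM/prE | move/prE/MS].
Qed.

Lemma idealr_ideal_set (p : idealr A) : ideal_set (fun a => a \in p).
Proof.
split; [exact: idealr0 | by move=> a b; apply: rpredD|].
by move=> a b; apply: idealMr.
Qed.

Lemma zero_ideal_set : ideal_set (fun a => a = 0).
Proof. by split=> // [a b -> ->|a b ->]; rewrite ?addr0 ?mulr0. Qed.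

End IdealSets.

(** * Integrality of finite extensions, and going up *)

Section Integral.
Variables (R A : comNzRingType) (phi : {rmorphism R -> A}).

Lemma horner_char_poly m (B : 'M[A]_m) z : (char_poly B).[z] = \det (z%:M - B).
Proof.
rewrite /char_poly -/(horner_eval z _) -det_map_mx; congr (\det _).
apply/matrixP=> i j; rewrite !mxE /= /horner_eval hornerD hornerN hornerC.
by congr (_ - _); rewrite hornerMn hornerX.
Qed.

(** The determinant trick: multiplication by z acts on the generators through a matrix over R, and
    by the adjugate identity its characteristic polynomial at z kills every generator, hence also
    1. *)
Lemma integral_of_finite (s : seq A) :
    (forall a, exists c : 'I_(size s) -> R, a = \sum_(j < size s) phi (c j) * s`_j) ->
  integralRange phi.
Proof.
move=> span z; have [c cE] := fin_all_exists (fun i : 'I_(size s) => span (z * s`_i)).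
pose M := \matrix_(i, j) c i j; pose B := map_mx phi M.
pose v := \col_(i < size s) s`_i.
exists (char_poly M); first exact: char_poly_monic.
rewrite map_char_poly /root horner_char_poly; set d := \det _.
have Bv : (z%:M - B) *m v = 0.
  apply/matrixP => i j; rewrite mulmxBl mul_scalar_mx !mxE cE.
  apply/eqP; rewrite subr_eq0; apply/eqP/eq_bigr => l _.
  by rewrite !mxE.
have dv j : d * s`_(j : 'I_(size s)) = 0.
  have /matrixP/(_ j 0) : d%:M *m v = 0 by rewrite -mul_adj_mx -mulmxA Bv mulmx0.
  by rewrite mul_scalar_mx !mxE.
have [e eE] := span 1.
rewrite -[d]mulr1 eE mulr_sumr big1 // => j _.
by rewrite mulrCA dv mulr0.
Qed.

(* Lying over for a kernel [q] of a morphism to a domain, enlarged by one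
   element [x] of [q]: if [phi g = a + b phi x] with [a] in [X], multiplying an
   integral equation of [b] by a power of [phi x] gives an equation
   [sum_l c_l x^(e-l) g^l] in [phi^-1 X], whence [g^e], and so [g], is in [q]. *)
Lemma going_up (K : idomainType) (sigma : {rmorphism R -> K}) (X : A -> Prop) x :
    integralRange phi -> ideal_set X -> (forall r, X (phi r) -> sigma r = 0) ->
    sigma x = 0 ->
  exists p : prime_idealr A, [/\ forall a, X a -> a \in p, phi x \in p
     & forall r, phi r \in p -> sigma r = 0].
Proof.
move=> int Xid Xsigma sx.
have Yid := adjoin_ideal (phi x) Xid.
have [X0 XD XM] := Xid.
pose S a := exists2 r, phi r = a & sigma r <> 0.
have [||||p [Yp pS]] := @prime_avoiding A (adjoin X (phi x)) S => //.
- by exists 1; rewrite rmorph1 //; apply/eqP/oner_neq0.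
- move=> _ _ [r <- /eqP r0] [r' <- /eqP r'0]; exists (r * r'); rewrite rmorphM //.
  by apply/eqP; rewrite mulf_neq0.
- move=> _ [m [b [Xm ->]]] [g phig]; apply.
  have [q /monicP qm /eqP qb] := int b.
  pose e := (size q).-1.
  have sq : size q = e.+1.
    rewrite /e prednK // lt0n size_poly_eq0; apply/eqP => q0.
    by move/eqP: qm; rewrite q0 lead_coef0 eq_sym oner_eq0.
  have qe : q`_e = 1 by rewrite -qm lead_coefE.
  pose G := \sum_(l < e.+1) q`_l * x ^+ (e - l) * g ^+ l.
  have qb' : \sum_(l < e.+1) phi q`_l * b ^+ l = 0.
    rewrite -[RHS]qb (@horner_coef_wide _ e.+1); last by rewrite -sq; apply: size_poly.
    by apply: eq_bigr => l _; rewrite coef_map.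
  have XG : X (phi G).
    have -> : phi G = \sum_(l < e.+1) phi (q`_l * x ^+ (e - l)) *
                         (phi g ^+ l - (b * phi x) ^+ l).
      transitivity (phi G - phi x ^+ e * (\sum_(l < e.+1) phi q`_l * b ^+ l)).
        by rewrite qb' mulr0 subr0.
      rewrite mulr_sumr rmorph_sum -sumrB; apply: eq_bigr => l _.
      rewrite mulrBr !rmorphM !rmorphXn /=; congr (_ - _).
      rewrite exprMn_comm; last exact: mulrC.
      rewrite -{1}(@subnK l e) -1?ltnS // exprD.
      by ring.
    have Xsub l : X (phi g ^+ l - (b * phi x) ^+ l).
      by rewrite subrXX mulrC; apply: XM; rewrite phig addrK.
    elim/big_ind: _ => // l _; exact: XM.
  have := Xsigma _ XG; rewrite rmorph_sum big_ord_recr /= big1 ?add0r => [|l _].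
    rewrite qe subnn expr0 !mul1r rmorphXn /= => /eqP.
    by rewrite expf_eq0 => /andP[_ /eqP].
  rewrite !rmorphM !rmorphXn sx expr0n subn_eq0 leqNgt ltn_ord /= .
  by rewrite mulr0 mul0r.
exists p; split=> [a Xa||r pr]; first exact/Yp/adjoin_sub.
  exact/Yp/adjoin_gen.
by apply: boolp.contrapT => nr; apply: (pS _ pr); exists r.
Qed.

End Integral.

(** * Independent families obtained from prime chains *)

Section Independence.
Variables (k : fieldType) (n : nat) (I : idealr {mpoly k[n]}).
Local Notation A := {ideal_quot I}.
Local Notation pi := (\pi_A : {mpoly k[n]} -> A).

(** Modulo p' only the term h 0 survives, so it vanishes by the assumption on h; what remains is a
    multiple of f, which the prime p allows to cancel. *)
Lemma powers_independent (B : comNzRingType) (p p' : prime_idealr B) f (h : nat -> B) t :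
    {subset p <= p'} -> f \in p' -> f \notin p ->
    (forall i, h i \in p' -> h i = 0) ->
  \sum_(i < t) f ^+ i * h i \in p -> forall i, (i < t)%N -> h i \in p'.
Proof.
move=> sub fp' fp; elim: t h => [//|t IH] h h0.
rewrite big_ord_recl expr0 mul1r => sump.
pose s := \sum_(i < t) f ^+ i * h i.+1.
have sE : \sum_(i < t) f ^+ bump 0 i * h (bump 0 i) = f * s.
  by rewrite mulr_sumr; apply: eq_bigr => i _; rewrite mulrA -exprS.
rewrite {}sE in sump.
have h0p' : h 0%N \in p'.
  rewrite -[h 0%N](addrK (f * s)); apply: rpredB; first exact: sub.
  by rewrite mulrC; apply: idealMr.
move: sump; rewrite (h0 _ h0p') add0r prime_idealrM (negPf fp) /= => sp.
case=> [//|i] lti; exact: (IH (fun i => h i.+1) (fun i => h0 i.+1) sp).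
Qed.

Lemma msize_exprM (f g : {mpoly k[n]}) i :
  (msize (f ^+ i * g)%R <= i * (msize f).+1 + msize g)%N.
Proof.
elim: i => [|i IH]; first by rewrite expr0 mul1r mul0n add0n.
rewrite exprS -mulrA; apply: leq_trans (msizeM_le _ _) _.
by rewrite mulSn -addnA addSn ltnS leq_add2l.
Qed.

(* If f lies in p_1 but not in p_0, the powers of f are independent over any
   family that is independent modulo p_1. *)
Lemma prime_chain_independent d (p : 'I_d.+1 -> prime_idealr A) :
    prime_chain p ->
  exists e, forall t, exists (T : finType) (g : T -> {mpoly k[n]}),
    [/\ #|T| = (t ^ d)%N, forall a, (msize (g a) <= (t * e).+1)%N
      & forall u : T -> k, pi (\sum_a u a *: g a) \in p ord0 -> forall a, u a = 0].
Proof.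
elim: d p => [|d IH] p chain.
  exists 0%N => t; exists unit, (fun=> 1); split; first by rewrite card_unit expn0.
    by move=> _; rewrite msize1.
  move=> u; rewrite (big_pred1 tt); last by case.
  move=> up [] ; apply/eqP; apply: contraFT (idealr1 (p ord0)) => u0.
  have -> : 1 = pi ((u tt)^-1%:MP) * pi (u tt *: 1).
    by rewrite -rmorphM /= -mul_mpolyC mulr1 -mpolyCM mulVf // mpolyC1 rmorph1.
  exact: idealMr.
have [|e He] := IH (fun i => p (lift ord0 i)).
  by move=> i j ij; apply: chain; rewrite !lift0.
have [sub [f' f'1 f'0]] := chain ord0 (lift ord0 ord0) isT.
pose f := repr f'; have piF : pi f = f' by rewrite reprK.
(* Fewer than t factors f occur, each adding at most [(msize f).+1] to the size; [e] serves the
   shorter chain. *)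
exists ((msize f).+1 + e)%N => t; have [T [g [cardT sizeg indg]]] := He t.
exists ('I_t * T)%type, (fun a : 'I_t * T => f ^+ a.1 * g a.2); split.
- by rewrite card_prod card_ord cardT expnS.
- move=> [i a] /=; apply: leq_trans (msize_exprM _ _ _) _.
  by rewrite mulnDr -addnS leq_add // leq_mul2r ltnW ?orbT.
(* Extended by zero to all natural indices, as [powers_independent] takes a sequence. *)
move=> u; pose G i := \sum_a (if insub i is Some j then u (j, a) else 0) *: g a.
have GE (j : 'I_t) : G j = \sum_a u (j, a) *: g a.
  by apply: eq_bigr => a _; rewrite valK.
have -> : \sum_a u a *: (f ^+ a.1 * g a.2) = \sum_(i < t) f ^+ i * G i.
  transitivity (\sum_(i < t) \sum_a u (i, a) *: (f ^+ i * g a)).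
    by rewrite pair_bigA; apply: eq_bigr => -[].
  apply: eq_bigr => i _; rewrite GE mulr_sumr; apply: eq_bigr => a _.
  by rewrite scalerAr.
rewrite rmorph_sum /= => sump [i a].
have h0 l : pi (G l) \in p (lift ord0 ord0) -> pi (G l) = 0.
  by move/indg => G0; rewrite /G big1 ?rmorph0 // => b _; rewrite G0 scale0r.
have : pi (G i) \in p (lift ord0 ord0).
  apply: (powers_independent (t := t) (h := fun l => pi (G l)) sub f'1 f'0 h0) => //.
  by rewrite -piF; under eq_bigr => l _ do rewrite -rmorphXn -rmorphM.
by rewrite GE => /indg.
Qed.

End Independence.

(** * Polynomials with restricted support *)

Section Supports.
Variables (k : fieldType) (n : nat).
Implicit Types (p q : {mpoly k[n]}) (Q : 'X_{1..n} -> Prop) (m : 'X_{1..n}).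

Definition supported Q p := forall m, m \in msupp p -> Q m.

Lemma supported0 Q : supported Q 0.
Proof. by move=> m; rewrite msupp0. Qed.

Lemma supportedD Q p q : supported Q p -> supported Q q -> supported Q (p + q).
Proof. by move=> Qp Qq m /msuppD_le; rewrite mem_cat => /orP[/Qp|/Qq]. Qed.

Lemma supportedZ Q c p : supported Q p -> supported Q (c *: p).
Proof. by move=> Qp m /msuppZ_le /Qp. Qed.

Lemma supportedB Q p q : supported Q p -> supported Q q -> supported Q (p - q).
Proof. by move=> Qp Qq; rewrite -scaleN1r; apply: supportedD => //; apply: supportedZ. Qed.

Lemma supportedX Q m : Q m -> supported Q 'X_[m].
Proof. by move=> Qm m' /mem_msuppXP <-. Qed.

Lemma supported_sum Q (J : Type) (r : seq J) (P : pred J) F :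
  (forall j, P j -> supported Q (F j)) -> supported Q (\sum_(j <- r | P j) F j).
Proof.
by move=> QF; apply: big_ind; [exact: supported0 | exact: supportedD | exact: QF].
Qed.

Lemma first_varsP D p :
  reflect (supported (fun m => forall i : 'I_n, (D <= i)%N -> m i = 0%N) p)
          (p \in first_vars D).
Proof.
apply: (iffP allP) => Dp m /Dp Dm; first by move=> i Di; apply/eqP/(implyP (forallP Dm i)).
by apply/forallP => i; apply/implyP => Di; apply/eqP/Dm.
Qed.

Lemma msize_supported d p :
  (msize p <= d)%N <-> supported (fun m => (mdeg m < d)%N) p.
Proof.
split=> [szp m /msize_mdeg_lt/leq_trans|sup]; first exact.
by rewrite msizeE big_seq; elim/big_ind: _ => // x y; rewrite geq_max => -> ->.
Qed.

Lemma mcoeff_pihomog d p m :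
  (pihomog mdeg d p)@_m = if mdeg m == d then p@_m else 0.
Proof.
elim/mpolyind: p => [|c m' p _ _ IH]; first by rewrite raddf0 mcoeff0 if_same.
rewrite linearP /= pihomogX !mcoeffD !mcoeffZ IH mcoeffX.
have [<-|ne] := eqVneq m' m; first by case: ifP => _; rewrite ?mcoeffX ?eqxx ?mcoeff0 ?mulr0 ?addr0.
by case: (mdeg m' == d); rewrite ?mcoeffX ?(negPf ne) ?mcoeff0 mulr0 !add0r.
Qed.

End Supports.

(** * Leading exponents of an ideal *)

Section LeadingExponents.
Variables (k : fieldType) (n : nat) (prec : rel 'X_{1..n}).
Hypothesis prec_to : term_order prec.
Implicit Types (f g : {mpoly k[n]}) (m mu nu rho : 'X_{1..n}) (I : idealr {mpoly k[n]}).

Lemma prec_asym mu nu : prec mu nu -> prec nu mu = false.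
Proof.
move=> lt; apply/negP => /(term_order_trans prec_to lt).
by rewrite (term_order_irr prec_to).
Qed.

Lemma lead_expP f : f != 0 -> lead_exp prec f \in msupp f /\
  forall m, m \in msupp f -> m != lead_exp prec f -> prec m (lead_exp prec f).
Proof.
rewrite -msupp_eq0 /lead_exp; elim: (msupp f) => // x s IH _.
have [->|s0] := eqVneq s [::].
  (* The initial value 0 of the fold is harmless, being the least exponent. *)
  rewrite big_cons big_nil; have -> : (if prec x 0%MM then 0%MM else x) = x.
    case: ifP => // x0; have [//|/(term_order_min prec_to)/prec_asym] := eqVneq x 0%MM.
    by rewrite x0.
  by rewrite mem_head; split=> // m; rewrite inE => ->.
have [] := IH s0; rewrite big_cons; set r := \big[_/_]_(_ <- s) _ => rs lt.
split; first by case: ifP => _; rewrite inE ?eqxx ?rs ?orbT.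
move=> m; rewrite inE => /orP[/eqP ->|ms]; case: ifP => // xr; rewrite ?eqxx //.
  exact: lt.
move=> mx; have [rx|rx] := eqVneq r x.
  by rewrite -rx; apply: lt; rewrite // rx.
have rx' : prec r x by have := term_order_total prec_to rx; rewrite xr orbF.
have [->//|mr] := eqVneq m r; exact: term_order_trans (lt _ ms mr) rx'.
Qed.

Lemma lead_expE f nu : nu \in msupp f ->
  (forall m, m \in msupp f -> m != nu -> prec m nu) -> lead_exp prec f = nu.
Proof.
move=> nuf lt; have f0 : f != 0.
  by rewrite -msupp_eq0; apply: contraTneq nuf => ->.
have [lf ltl] := lead_expP f0; apply/eqP; apply: contraT => ne.
have := lt _ lf ne; rewrite prec_asym //; apply: ltl => //.
by rewrite eq_sym.
Qed.

Variable I : idealr {mpoly k[n]}.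
Local Notation L := (lead_exps prec I).

Lemma lead_exps_addr nu rho : L nu -> L (nu + rho)%MM.
Proof.
move=> [f [fI f0 <-]]; have [lf lt] := lead_expP f0.
have memMX m : (m \in msupp (f * 'X_[rho])) ->
    exists2 m', m' \in msupp f & m = (m' + rho)%MM.
  by rewrite (perm_mem (msuppMX f rho)) => /mapP[m' m'f ->]; exists m'; rewrite // addmC.
exists (f * 'X_[rho]); split; first by rewrite mulrC; apply: idealMr.
  by rewrite mulf_neq0 // -msupp_eq0 msuppX.
apply: lead_expE.
  by rewrite (perm_mem (msuppMX f rho)) addmC map_f.
move=> _ /memMX[m' m'f ->]; rewrite eqm_add2r => ne.
exact/(term_order_add prec_to)/lt.
Qed.

Lemma lead_exps_le nu mu : (nu <= mu)%MM -> L nu -> L mu.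
Proof. by move=> /submK <- Lnu; rewrite addmC; apply: lead_exps_addr. Qed.

(** As 0 is the least exponent, a polynomial with leading exponent 0 is a non-zero constant, whereas
    [I] is proper. *)
Lemma lead_exps0 : ~ L 0%MM.
Proof.
move=> [f [fI f0 lf]]; have [l0 lt] := lead_expP f0; rewrite lf in l0 lt.
have fE : f = (f@_0%MM)%:MP.
  apply/mpolyP => m; rewrite mcoeffC; have [->|m0] := eqVneq m 0%MM.
    by rewrite mulr1.
  rewrite mulr0; apply/eqP; rewrite mcoeff_eq0; apply/negP => mf.
  by have := lt _ mf m0; rewrite prec_asym ?(term_order_min prec_to).
rewrite mcoeff_msupp in l0; have := idealr1 I.
have -> : 1 = (f@_0%MM)^-1%:MP * f by rewrite {2}fE -mpolyCM mulVf // mpolyC1.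
by rewrite idealMr.
Qed.

(** The homogeneous component of f in the degree of its leading exponent stays in [I]; dividing by
    the leading coefficient makes it monic. *)
Lemma lead_exps_homog nu : homog_ideal I -> L nu ->
  exists g, [/\ g \in I, g@_nu = 1
    & supported (fun m => m = nu \/ (prec m nu /\ mdeg m = mdeg nu)) g].
Proof.
move=> homI [f [fI f0 <-]]; have [] := lead_expP f0; set nu' := lead_exp _ _.
rewrite mcoeff_msupp => l0 lt.
exists ((f@_nu')^-1%:MP * pihomog mdeg (mdeg nu') f); split.
- exact/idealMr/homI.
- by rewrite mcoeffCM mcoeff_pihomog eqxx mulVf.
rewrite mul_mpolyC; apply: supportedZ => m.
rewrite mcoeff_msupp mcoeff_pihomog; case: ifP => [/eqP dm|_]; last by rewrite eqxx.
rewrite -mcoeff_msupp => mf.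
by have [->|ne] := eqVneq m nu'; [left | right; split=> //; apply: lt].
Qed.

End LeadingExponents.

(** * Pure powers among the leading exponents, and the candidate dimension *)

Section QuasiStable.
Variables (k : fieldType) (n : nat) (prec : rel 'X_{1..n}).
Hypothesis prec_to : term_order prec.
Variables (I : idealr {mpoly k[n]}) (H : seq {mpoly k[n]}).
Hypothesis H_pommaret : pommaret_basis prec I H.
Local Notation L := (lead_exps prec I).

Lemma cls_le (mu : 'X_{1..n}) (i : 'I_n) : mu i != 0%N -> (cls mu <= i.+1)%N.
Proof.
rewrite /cls => mui; elim: (index_enum _) (mem_index_enum i) => // j s IH.
rewrite big_cons inE => /orP[/eqP <-|/IH le]; first by rewrite mui geq_minl.
by case: ifP => // _; apply: leq_trans le; apply: geq_minr.
Qed.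

Definition cone_bound := (\max_(h <- H) mdeg (lead_exp prec h)).+1.

(* Once its [c]-th entry exceeds all those of the basis, an exponent of [L]
   supported in the variables up to [c] lies in a cone along the [c]-th
   direction, so the vertex of this cone has class [c]. *)
Lemma pure_power_lead_exps nu (c : 'I_n) : L nu ->
  (forall i : 'I_n, (c < i)%N -> nu i = 0%N) -> L (U_(c) *+ cone_bound)%MM.
Proof.
move=> Lnu nu0; have Lnu' := lead_exps_addr prec_to (U_(c) *+ cone_bound)%MM Lnu.
have [h hH [rho rho0 E]] := proj1 (pommaret_cover H_pommaret _) Lnu'.
set mu := lead_exp prec h in rho0 E.
have Lmu : L mu by have [hI h0] := pommaret_sub H_pommaret hH; exists h.
have mu_lt i : (mu i < cone_bound)%N.
  rewrite ltnS; apply: leq_trans (leq_bigmax_seq _ hH isT).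
  by rewrite mdegE (bigD1 i) //= leq_addr.
have Ei i : (nu i + (c == i) * cone_bound = mu i + rho i)%N.
  by move/mnmP/(_ i): E; rewrite !mnmDE mulmnE mnm1E.
have rhoc : rho c != 0%N.
  by have := Ei c; have := mu_lt c; rewrite eqxx; lia.
have clsc : (c < cls mu)%N.
  by rewrite leqNgt; apply/negP => /rho0 r0; rewrite r0 in rhoc.
(* The vertex [mu] is itself a power of the variable [c]: a non-zero entry before [c] would lower
   its class, and one after [c] contradicts the vanishing of [nu] there. *)
apply: (lead_exps_le prec_to) Lmu; apply/mnm_lepP => i.
rewrite mulmnE mnm1E; have [_|ic] := eqVneq c i; first by rewrite mul1n ltnW.
have [->|mui] := eqVneq (mu i) 0%N; first by [].
have := cls_le mui => ci.
by have := Ei i; rewrite (negPf ic) nu0; move: ic; rewrite -val_eqE /=; lia.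
Qed.

(** Let m be least such that [L] has an exponent involving only the first m variables; then D = m -
    1. That exponent yields the pure powers, minimality of m the last clause, and m > 0 because 0 is
    not in [L]. *)
Lemma quasi_stable_dim : (exists nu, L nu) ->
  exists D, [/\ (D <= n)%N,
    forall c : 'I_n, (D <= c)%N -> L (U_(c) *+ cone_bound)%MM
    & forall nu, L nu -> exists2 i : 'I_n, (D <= i)%N & nu i != 0%N].
Proof.
move=> [nu0 Lnu0].
pose Q (m : nat) nu := L nu /\ forall i : 'I_n, (m <= i)%N -> nu i = 0%N.
have exQ : exists m, boolp.asbool (exists nu, Q m nu).
  exists n; apply/boolp.asboolP; exists nu0; split=> // i.
  by rewrite leqNgt ltn_ord.
case: (ex_minnP exQ) => m /boolp.asboolP[nu [Lnu nuz]] minm.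
have m_gt0 : (0 < m)%N.
  rewrite lt0n; apply/eqP => m0; apply: (@lead_exps0 _ _ _ prec_to I).
  by have <- : nu = 0%MM by apply/mnmP => i; rewrite mnm0E nuz // m0.
exists m.-1; split.
- apply: leq_trans (leq_pred _) (minm _ _); apply/boolp.asboolP; exists nu0.
  by split=> // i; rewrite leqNgt ltn_ord.
- move=> c mc; apply: (pure_power_lead_exps Lnu) => i ci; apply: nuz; lia.
- move=> mu Lmu; apply: boolp.contrapT => none.
  have : (m <= m.-1)%N; last by lia.
  apply: minm; apply/boolp.asboolP; exists mu; split=> // i mi.
  by apply/eqP; apply: contraT => mui; case: none; exists i.
Qed.

End QuasiStable.

(** * Normal forms modulo a homogeneous ideal *)

Section NormalForms.
Variables (k : fieldType) (n : nat) (prec : rel 'X_{1..n}).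
Hypothesis prec_to : term_order prec.
Variable I : idealr {mpoly k[n]}.
Hypothesis I_homog : homog_ideal I.
Implicit Types (f g : {mpoly k[n]}) (m : 'X_{1..n}) (Q : 'X_{1..n} -> Prop).

Definition reducible_to Q f := exists2 g, f - g \in I & supported Q g.

Lemma reducible_sum Q (J : Type) (r : seq J) (P : pred J) F :
  (forall j, P j -> reducible_to Q (F j)) ->
  reducible_to Q (\sum_(j <- r | P j) F j).
Proof.
move=> QF; apply: (big_ind (reducible_to Q)) => [|f f' [g fg Qg] [g' fg' Qg']|//].
  by exists 0; [rewrite subr0 idealr0 | apply: supported0].
by exists (g + g'); [rewrite opprD addrACA rpredD | apply: supportedD].
Qed.

Lemma reducibleZ Q c f : reducible_to Q f -> reducible_to Q (c *: f).
Proof.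
move=> [g fg Qg]; exists (c *: g); last exact: supportedZ.
by rewrite -scalerBr -mul_mpolyC; apply: idealMr.
Qed.

Lemma reducible_supported Q f :
  supported (fun m => reducible_to Q 'X_[m]) f -> reducible_to Q f.
Proof.
move=> Qf; rewrite [f]mpolyE big_seq; apply: reducible_sum => m /Qf.
exact: reducibleZ.
Qed.

(** Its cardinality is the measure for termination: bounded exponents form a finite type, so no
    well-foundedness of the term order has to be established. *)
Definition preceding m : {set 'X_{1..n < (mdeg m).+1}} :=
  [set m' : 'X_{1..n < (mdeg m).+1} | (mdeg m' == mdeg m) && prec m' m].

Lemma preceding_lt m m' : prec m' m -> mdeg m' = mdeg m ->
  (#|preceding m'| < #|preceding m|)%N.
Proof.
rewrite /preceding => lt E; rewrite E; apply/proper_card/properP; split.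
  apply/subsetP => x; rewrite !inE => /andP[->] /= xm'.
  exact: (term_order_trans prec_to xm' lt).
have dm' : (mdeg m' < (mdeg m).+1)%N by rewrite E.
exists (BMultinom dm'); rewrite !inE /= E eqxx //=.
by rewrite (term_order_irr prec_to).
Qed.

(** If m is not reduced, subtracting a monic homogeneous element of [I] with leading exponent m
    leaves only smaller monomials of the same degree. *)
Lemma normal_monomial (red : pred 'X_{1..n}) m :
    (forall m, ~~ red m -> lead_exps prec I m) ->
  reducible_to (fun m' => red m' /\ mdeg m' = mdeg m) 'X_[m].
Proof.
move=> redP; have [r] := ubnP #|preceding m|; elim: r m => // r IH m.
rewrite ltnS => ltr; have [redm|/redP/(lead_exps_homog prec_to I_homog)] := boolP (red m).
  by exists 'X_[m]; [rewrite subrr idealr0 | apply: supportedX].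
move=> [h [hI hm suph]].
have [|g fg Qg] := @reducible_supported (fun m' => red m' /\ mdeg m' = mdeg m) ('X_[m] - h).
  move=> m' m'supp; have : m' != m.
    apply: contraTneq m'supp => ->.
    by rewrite mcoeff_msupp mcoeffB mcoeffX eqxx hm subrr eqxx.
  have [|->|[lt E] _] := supportedB (supportedX _) suph m'supp; first by left.
    by rewrite eqxx.
  by rewrite -E; apply: IH; apply: leq_trans (preceding_lt lt E) ltr.
by exists g => //; rewrite -(subrK h 'X_[m]) addrAC rpredD.
Qed.

Lemma normal_form (red : pred 'X_{1..n}) f d :
    (forall m, ~~ red m -> lead_exps prec I m) -> (msize f <= d)%N ->
  reducible_to (fun m => red m /\ (mdeg m < d)%N) f.
Proof.
move=> redP /msize_supported szf; apply: reducible_supported => m /szf md.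
have [g fg Qg] := normal_monomial m redP.
by exists g => // m' /Qg[? ->].
Qed.

End NormalForms.

(** * Exponents that are bounded beyond the first D variables *)

Section Reduced.
Variables (n D E : nat).
Hypothesis Dn : (D <= n)%N.
Implicit Types (m : 'X_{1..n}).

Definition tail_bounded : pred 'X_{1..n} := fun m =>
  [forall i : 'I_n, (D <= i)%N ==> (m i < E)%N].

Lemma tail_boundedP m :
  reflect (forall i : 'I_n, (D <= i)%N -> (m i < E)%N) (tail_bounded m).
Proof.
apply: (iffP forallP) => Em i; first exact/implyP.
exact/implyP/Em.
Qed.

(** Entries range over ['I_E.+1] rather than ['I_E] so that the value 0 exists even for E = 0. *)
Definition tail_mnm (t : {ffun 'I_n -> 'I_E.+1}) : 'X_{1..n} :=
  [multinom (t i : nat) | i < n].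

Definition mnm_head m : 'X_{1..n} := [multinom if (i < D)%N then m i else 0%N | i < n].

Definition mnm_tail m : {ffun 'I_n -> 'I_E.+1} :=
  [ffun i : 'I_n => if (i < D)%N then ord0 else inord (m i)].

Lemma mnm_head_tail m : tail_bounded m -> m = (mnm_head m + tail_mnm (mnm_tail m))%MM.
Proof.
move=> /tail_boundedP mE; apply/mnmP => i; rewrite mnmDE !mnmE ffunE.
case: ltnP => [_|/mE lt]; first by rewrite addn0.
by rewrite inordK // ltnW.
Qed.

(** The pairs form a finite type of (d+1)^D (E+1)^n elements. It has to reach every bounded
    exponent, not injectively, since it serves for upper bounds. *)
Definition join_mnm d (x : {ffun 'I_D -> 'I_d.+1} * {ffun 'I_n -> 'I_E.+1}) : 'X_{1..n} :=
  [multinom if insub (i : nat) is Some j then x.1 j : nat else x.2 i | i < n].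

Lemma tail_bounded_join d m : tail_bounded m -> (mdeg m <= d)%N ->
  exists x, m = @join_mnm d x.
Proof.
move=> /tail_boundedP mE md.
exists ([ffun j : 'I_D => inord (m (widen_ord Dn j))], mnm_tail m).
apply/mnmP => i; rewrite mnmE; case: insubP => [j _ ji|] /=; rewrite ffunE.
  have -> : widen_ord Dn j = i by apply: val_inj.
  by rewrite inordK // ltnS (leq_trans _ md) // mdegE (bigD1 i) //= leq_addr.
by rewrite -leqNgt => Di; rewrite ltnNge Di inordK // ltnW //; apply: mE.
Qed.

End Reduced.

(** * Finite spanning families, linear dependence and growth *)

Section Representation.
Variables (k : fieldType) (n : nat).

(** Stated for general coefficients to serve twice: with coefficients in k[x_1, ..., x_D] for module
    generators, and in k for counting dimensions. *)
Lemma combination_of_monomials (B : zmodType) (pi : {additive {mpoly k[n]} -> B})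
    (X : finType) (V : nmodType) (C : V -> Prop) (act : V -> X -> B) g :
    C 0 -> (forall u v, C u -> C v -> C (u + v)) ->
    (forall x, act 0 x = 0) -> (forall x u v, act (u + v) x = act u x + act v x) ->
    (forall m, m \in msupp g -> exists x v, C v /\ pi (g@_m *: 'X_[m]) = act v x) ->
  exists c : X -> V, (forall x, C (c x)) /\ pi g = \sum_x act (c x) x.
Proof.
move=> C0 CD act0 actD mono.
rewrite [g in pi g]mpolyE big_seq raddf_sum.
pose P b := exists c : X -> V, (forall x, C (c x)) /\ b = \sum_x act (c x) x.
apply: (big_ind P) => [|_ _ [c [Cc ->]] [c' [Cc' ->]]|m /mono[x [v [Cv ->]]]].
- by exists (fun=> 0); split=> //; rewrite big1.
- exists (fun x => c x + c' x); split=> [x|]; first exact: CD.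
  by rewrite -big_split; apply: eq_bigr => x _; rewrite actD.
- exists (fun y => if y == x then v else 0); split=> [y|]; first by case: ifP.
  rewrite (bigD1 x) //= eqxx big1 ?addr0 // => y /negPf ->.
  exact: act0.
Qed.

End Representation.

Lemma linear_dependence (F : fieldType) (T Y : finType) (M : T -> Y -> F) :
  (#|Y| < #|T|)%N ->
  exists2 u : T -> F, (exists a, u a != 0) & forall y, \sum_a u a * M a y = 0.
Proof.
move=> ltYT; pose B := \matrix_(i < #|T|, j < #|Y|) M (enum_val i) (enum_val j).
have : kermx B != 0.
  rewrite -mxrank_eq0 mxrank_ker subn_eq0 -ltnNge.
  exact: leq_ltn_trans (rank_leq_col B) ltYT.
case/rowV0Pn => v /sub_kermxP vB /rV0Pn[i vi].
exists (fun a => v 0 (enum_rank a)); first by exists (enum_val i); rewrite enum_valK.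
move=> y; have /matrixP/(_ 0 (enum_rank y)) := vB.
rewrite !mxE => E0; apply: (etrans _ E0); rewrite {E0} [RHS](reindex enum_rank) /=; last first.
  by exists enum_val => x _; rewrite ?enum_rankK ?enum_valK.
by apply: eq_bigr => a _; rewrite !mxE !enum_rankK.
Qed.

(** If D < d, then t^(D+1) <= t^d <= t^D (e+1)^D C for t > 0, which fails at t = (e+1)^D C + 1. *)
Lemma leq_of_exp_growth d D e C :
  (forall t, t ^ d <= (t * e).+1 ^ D * C)%N -> (d <= D)%N.
Proof.
move=> le; rewrite leqNgt; apply/negP => ltDd.
pose t := (e.+1 ^ D * C).+1.
have : (t ^ D.+1 <= t ^ D * (e.+1 ^ D * C))%N.
  apply: leq_trans (leq_trans (le t) _); first exact: leq_pexp2l.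
  rewrite mulnA -expnMn leq_mul2r; apply/orP; right.
  by case: (D) => // D'; rewrite leq_exp2r // mulnS addnC -addn1 leq_add2l.
by rewrite expnSr leq_pmul2l ?expn_gt0 // /t ltnn.
Qed.

Lemma noether_of_family (k : fieldType) n (I : idealr {mpoly k[n]}) D (X : finType)
    (w : X -> {ideal_quot I}) :
    (forall a : {ideal_quot I}, exists c : X -> {mpoly k[n]},
       (forall x, c x \in first_vars D) /\
       a = \sum_x \pi_({ideal_quot I}) (c x) * w x) ->
  exists s : seq {ideal_quot I}, forall a : {ideal_quot I},
    exists c : 'I_(size s) -> {mpoly k[n]},
      (forall j, c j \in first_vars D) /\
      a = \sum_(j < size s) \pi_({ideal_quot I}) (c j) * s`_j.
Proof.
move=> span; exists (codom w) => a; have [c [cD ->]] := span a.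
exists (fun j => c (enum_val (cast_ord (size_codom w) j))); split=> [j //|].
rewrite (reindex (fun j => enum_val (cast_ord (size_codom w) j))) /=; last first.
  exists (fun x => cast_ord (esym (size_codom w)) (enum_rank x)) => x _.
    by rewrite enum_valK cast_ordK.
  by rewrite cast_ordKV enum_rankK.
apply: eq_bigr => j _; congr (_ * _).
exact: esym (nth_codom 0 w (cast_ord (size_codom w) j)).
Qed.

(** * The Noether normalisation and the upper bound for the dimension *)

Section Normalisation.
Variables (k : fieldType) (n : nat) (prec : rel 'X_{1..n}).
Hypothesis prec_to : term_order prec.
Variable I : idealr {mpoly k[n]}.
Hypothesis I_homog : homog_ideal I.
Local Notation L := (lead_exps prec I).
Local Notation A := {ideal_quot I}.
Local Notation pi := (\pi_A : {mpoly k[n]} -> A).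
Variables D E : nat.
Hypothesis Dn : (D <= n)%N.
Hypothesis L_powers : forall c : 'I_n, (D <= c)%N -> L (U_(c) *+ E)%MM.
Hypothesis L_tail : forall nu, L nu -> exists2 i : 'I_n, (D <= i)%N & nu i != 0%N.

Lemma pi_eq f g : (pi f == pi g) = (f - g \in I).
Proof. by rewrite -Quotient.idealrBE. Qed.

Lemma tail_unbounded_lead m : ~~ tail_bounded D E m -> L m.
Proof.
rewrite negb_forall => /existsP[i]; rewrite negb_imply -leqNgt => /andP[Di Em].
apply: (lead_exps_le prec_to) (L_powers Di); apply/mnm_lepP => j.
rewrite mulmnE mnm1E; case: eqVneq => [<-|//]; by rewrite mul1n.
Qed.

(** A non-zero difference in [I] would have a leading exponent in the first D variables only,
    against [L_tail]. *)
Lemma first_vars_pi_inj : {in first_vars D &, injective pi}.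
Proof.
move=> f g /first_varsP fD /first_varsP gD /eqP; rewrite pi_eq => fgI.
apply/eqP; rewrite -subr_eq0; apply: contraT => fg0.
have [lf _] := lead_expP prec_to fg0.
have [|i Di] := L_tail (nu := lead_exp prec (f - g)); first by exists (f - g).
by rewrite (supportedB fD gD lf).
Qed.

(** Each monomial of a normal form is a monomial in the first D variables times one of finitely many
    tails, so the classes of the tails generate [A] as a module. *)
Lemma noether_normal : noether_normalisation D I.
Proof.
split; first exact: first_vars_pi_inj.
apply: (@noether_of_family _ _ _ _ _
  (fun t : {ffun 'I_n -> 'I_E.+1} => pi 'X_[tail_mnm t])) => a.
have [g ag Qg] := normal_form prec_to I_homog tail_unbounded_lead (leqnn (msize (repr a))).
have [||||| c [cD cE]] := @combination_of_monomials k n A pi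
  _ {mpoly k[n]} (fun v => v \in first_vars D) (fun v (t : {ffun 'I_n -> 'I_E.+1}) => pi v * pi 'X_[tail_mnm t]) g.
- by apply/first_varsP; exact: supported0.
- by move=> u v /first_varsP uD /first_varsP vD; apply/first_varsP; exact: supportedD.
- by move=> x; rewrite raddf0 mul0r.
- by move=> x u v; rewrite raddfD mulrDl.
- move=> m /Qg[mb _]; exists (mnm_tail D E m), (g@_m *: 'X_[mnm_head D m]); split.
    apply/first_varsP; apply: supportedZ; apply: supportedX => i Di.
    by rewrite mnmE ltnNge Di.
  by rewrite -rmorphM /= -scalerAl -mpolyXD -mnm_head_tail.
exists c; split=> //; rewrite -cE -[a]reprK; apply/eqP.
by rewrite pi_eq.
Qed.

Lemma box_combination d f : (msize f <= d.+1)%N ->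
  exists c : {ffun 'I_D -> 'I_d.+1} * {ffun 'I_n -> 'I_E.+1} -> k,
    pi f = \sum_x pi (c x *: 'X_[join_mnm x]).
Proof.
move=> szf; have [g fg Qg] := normal_form prec_to I_homog tail_unbounded_lead szf.
have [||||| c [_ cE]] := @combination_of_monomials k n A pi
  _ k (fun=> True) (fun v (x : {ffun 'I_D -> 'I_d.+1} * {ffun 'I_n -> 'I_E.+1}) => pi (v *: 'X_[@join_mnm n D E d x])) g => //.
- by move=> x; rewrite scale0r raddf0.
- by move=> x u v; rewrite scalerDl raddfD.
- move=> m /Qg[mb md]; have [x mE] := tail_bounded_join Dn mb md.
  by exists x, g@_m; rewrite -mE.
by exists c; rewrite -cE; apply/eqP; rewrite pi_eq.
Qed.

(** The t^d independent elements have degree at most te, so their normal forms lie in the span of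
    (te+1)^D (E+1)^n monomials; were there fewer monomials than elements, a dependence would
    result. *)
Lemma prime_chain_length d (p : 'I_d.+1 -> prime_idealr A) :
  prime_chain p -> (d <= D)%N.
Proof.
move=> /prime_chain_independent[e He].
apply: (@leq_of_exp_growth _ _ e (E.+1 ^ n)%N) => t.
have [T [g [cardT sizeg indg]]] := He t; rewrite -cardT.
set X := ({ffun 'I_D -> 'I_(t * e).+1} * {ffun 'I_n -> 'I_E.+1})%type.
have <- : #|{: X}| = ((t * e).+1 ^ D * E.+1 ^ n)%N.
  by rewrite card_prod !card_ffun !card_ord.
rewrite leqNgt; apply/negP => ltX.
have [M ME] := fin_all_exists (fun a => box_combination (sizeg a)).
have [u [a ua] uM] := linear_dependence M ltX.
move/eqP: ua; apply; apply: indg.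
suff -> : pi (\sum_a u a *: g a) = 0 by apply: idealr0.
have piZ c f : pi (c *: f) = pi c%:MP * pi f by rewrite -rmorphM /= mul_mpolyC.
rewrite raddf_sum /=; under eq_bigr => b _ do rewrite piZ ME mulr_sumr.
rewrite exchange_big big1 // => x _.
under eq_bigr => b _ do rewrite -piZ scalerA.
by rewrite -raddf_sum -scaler_suml uM scale0r raddf0.
Qed.

End Normalisation.

(** * A prime chain of length D *)

Section ChainExists.
Variables (k : fieldType) (n D : nat) (I : idealr {mpoly k[n]}).
Hypothesis Dn : (D <= n)%N.
Hypothesis I_noether : noether_normalisation D I.
Local Notation A := {ideal_quot I}.
Local Notation pi := (\pi_A : {mpoly k[n]} -> A).

(* Substituting it projects onto k[x_(i+1), ..., x_D], with kernel (x_1, ..., x_i)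
   on k[x_1, ..., x_D]. *)
Definition window (i : nat) : n.-tuple {mpoly k[n]} :=
  [tuple if (i <= j < D)%N then 'X_j else 0 | j < n].

Lemma windowX i (j : 'I_n) :
  'X_j \mPo window i = if (i <= j < D)%N then 'X_j else 0.
Proof. by rewrite comp_mpolyXU -tnth_nth tnth_mktuple. Qed.

Lemma window_comp i j (f : {mpoly k[n]}) : (i <= j)%N ->
  (f \mPo window i) \mPo window j = f \mPo window j.
Proof.
move=> ij; rewrite (comp_mpolyEX f (window i)) [RHS]comp_mpolyEX raddf_sum.
apply: eq_bigr => m _; rewrite [LHS]comp_mpolyZ; congr (_ *: _).
rewrite !comp_mpolyX rmorph_prod; apply: eq_bigr => l _.
rewrite rmorphXn /= !tnth_mktuple; congr (_ ^+ _).
case: ifP => [_|il]; first by rewrite windowX.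
rewrite comp_mpoly0; case: ifP => // jl; lia.
Qed.

Lemma first_vars_window f : f \mPo window 0 \in first_vars D.
Proof.
apply/first_varsP; elim/mpolyind: f => [|c m f _ _ IH].
  by rewrite comp_mpoly0; apply: supported0.
rewrite comp_mpolyD comp_mpolyZ; apply: supportedD => //; apply: supportedZ.
rewrite comp_mpolyX.
have [m0|] := boolP [forall i : 'I_n, (D <= i)%N ==> (m i == 0%N)].
  have -> : \prod_(i < n) tnth (window 0) i ^+ m i = 'X_[m] :> {mpoly k[n]}.
    rewrite [RHS]mpolyXE_id; apply: eq_bigr => i _; rewrite tnth_mktuple /=.
    case: ltnP => // Di; have /implyP/(_ Di)/eqP -> := forallP m0 i.
    by rewrite !expr0.
  apply: supportedX => i Di; exact/eqP/(implyP (forallP m0 i)).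
rewrite negb_forall => /existsP[i]; rewrite negb_imply => /andP[Di mi].
rewrite (bigD1 i) //= tnth_mktuple /= ltnNge Di expr0n (negPf mi) mul0r.
exact: supported0.
Qed.

Lemma window_first_vars f : f \in first_vars D -> f \mPo window 0 = f.
Proof.
move=> /first_varsP fD; rewrite [in RHS](mpolyE f) comp_mpolyEX.
rewrite !big_seq; apply: eq_bigr => m /fD m0; congr (_ *: _).
rewrite comp_mpolyX [RHS]mpolyXE_id; apply: eq_bigr => i _.
rewrite tnth_mktuple /=; case: ltnP => // /m0 ->.
by rewrite !expr0.
Qed.

(** The restriction of [pi] to k[x_1, ..., x_D], with the later variables first sent to 0: its
    source is then a full polynomial ring instead of a subring given by a predicate. *)
Definition noether_map : {mpoly k[n]} -> A := pi \o comp_mpoly (window 0).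

HB.instance Definition _ := GRing.RMorphism.on noether_map.

Lemma noether_map_integral : integralRange noether_map.
Proof.
have [_ [s span]] := I_noether; apply: (integral_of_finite (s := s)) => a.
have [c [cD ->]] := span a; exists c; apply: eq_bigr => j _.
by rewrite /= /noether_map /= window_first_vars.
Qed.

(** The last clause is the invariant of the induction: [p m] contracts into (x_1, ..., x_m). Going
    up then adds x_(m+1), which makes the new inclusion strict. *)
Lemma prime_lifts m : (m <= D)%N ->
  exists p : nat -> prime_idealr A,
    (forall i, (i < m)%N -> {subset p i <= p i.+1} /\
       exists2 a, a \in p i.+1 & a \notin p i) /\
    forall r, noether_map r \in p m -> r \mPo window m = 0.
Proof.
elim: m => [|m IH] mD.
  (* The chain starts over the zero ideal, whose contraction is zero because the normalisation is
     injective; nothing is adjoined, hence x = 0. *)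
  have [|p [_ _ p0]] := @going_up _ A noether_map _ (comp_mpoly (window 0))
    (fun a => a = 0) 0 noether_map_integral (zero_ideal_set A) _ (comp_mpoly0 _).
    move=> r r0; have [inj _] := I_noether; apply: inj.
    - exact: first_vars_window.
    - by apply/first_varsP; exact: supported0.
    - by rewrite rmorph0.
  by exists (fun=> p); split.
have [p [chain pm]] := IH (ltnW mD).
have mn : (m < n)%N := leq_trans mD Dn.
pose x : {mpoly k[n]} := 'X_(Ordinal mn).
have [||q [pq xq q0]] := @going_up _ A noether_map _ (comp_mpoly (window m.+1))
    (fun a => a \in p m) x noether_map_integral (idealr_ideal_set (p m)).
- by move=> r /pm r0 /=; rewrite -(window_comp r (leqnSn m)) r0 comp_mpoly0.
- by rewrite /= windowX /= ltnn.
exists (fun i => if (i <= m)%N then p i else q); split; last by rewrite ltnn.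
move=> i im1; have [->|im] := eqVneq i m.
  rewrite leqnn ltnn; split=> //; exists (noether_map x) => //.
  apply/negP => /pm; rewrite windowX /= leqnn mD => /eqP.
  by rewrite -msupp_eq0 msuppX.
have {im} im : (i < m)%N by rewrite ltn_neqAle im -ltnS.
by rewrite im (ltnW im); apply: chain.
Qed.

Lemma prime_chain_exists : exists p : 'I_D.+1 -> prime_idealr A, prime_chain p.
Proof.
have [p [chain _]] := prime_lifts (leqnn D).
exists (fun i => p i) => i j ij.
have sub l : (i.+1 + l <= j)%N -> {subset p i.+1 <= p (i.+1 + l)%N}.
  elim: l => [|l IH]; first by rewrite addn0 => _ a.
  rewrite addnS => lj a /IH-/(_ (ltnW lj)); apply: (chain _ _).1.
  by apply: leq_trans lj _; rewrite -ltnS.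
have ltiD : (i < D)%N by apply: leq_trans ij _; rewrite -ltnS.
have [subi [a a1 a0]] := chain _ ltiD.
have subj : {subset p i.+1 <= p j} by have := sub (j - i.+1)%N; rewrite subnKC // => /(_ (leqnn j)).
by split=> [b /subi/subj//|]; exists a; [exact: subj|].
Qed.

End ChainExists.

(** * Monic equations for the lexicographic orders *)

Section Lexicographic.
Variables (k : fieldType) (n : nat) (I : idealr {mpoly k[n]}) (i : 'I_n) (e : nat).
Implicit Types (g : {mpoly k[n]}) (m : 'X_{1..n}).

Definition lex_below m :=
  [/\ (m i < e)%N, forall j : 'I_n, (i < j)%N -> m j = 0%N & mdeg m = e].

(** At the last differing position the pure power has the larger entry, hence a positive one, so
    this position is [i]. *)
Lemma lex_lt_power m : lex_lt m (U_(i) *+ e)%MM -> mdeg m = e -> lex_below m.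
Proof.
move=> /existsP[j /andP[]]; rewrite mulmnE mnm1E.
have [<-|//] := eqVneq i j; rewrite mul1n => lt /forallP eqm dm; split=> // l il.
have /implyP/(_ il)/eqP -> := eqm l.
by rewrite mulmnE mnm1E -val_eqE /= ltn_eqF.
Qed.

(** The terms of g other than x_i^e are grouped by their exponent l < e in x_i; no later variable
    occurs, and since all terms have degree e, the coefficient [P l] has degree at most e - l. *)
Lemma monic_equation g : g \in I -> g@_(U_(i) *+ e) = 1 ->
    supported (fun m => m = (U_(i) *+ e)%MM \/ lex_below m) g ->
  exists P : 'I_e -> {mpoly k[n]},
    [/\ forall j, P j \in first_vars i,
        forall j, P j != 0 -> ((msize (P j)).-1 + j <= e)%N
      & 'X_i ^+ e + \sum_(j < e) P j * 'X_i ^+ j \in I].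
Proof.
move=> gI g1 supg; set nu := (U_(i) *+ e)%MM in g1 supg *.
have below m : m \in msupp g -> m != nu -> lex_below m.
  by move=> /supg[->|//]; rewrite eqxx.
have nug : nu \in msupp g by rewrite mcoeff_msupp g1 oner_neq0.
pose P (l : 'I_e) := \sum_(m <- msupp g | (m \in msupp g) && ((m != nu) && (m i == l :> nat)))
  g@_m *: 'X_[m - U_(i) *+ l].
have supP Q (l : 'I_e) : (forall m, lex_below m -> m i = l :> nat -> Q (m - U_(i) *+ l)%MM) ->
    supported Q (P l).
  move=> Qm; apply: supported_sum => m /andP[mg /andP[/(below _ mg) bm /eqP mi]].
  by apply: supportedZ; apply: supportedX; apply: Qm.
exists P; split=> [l|l _|].
- apply/first_varsP; apply: supP => m [_ m0 _] mi j; rewrite mnmBE mulmnE mnm1E.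
  rewrite leq_eqVlt => /orP[/eqP/val_inj <-|ij]; first by rewrite eqxx mi mul1n subnn.
  by rewrite m0.
- have /msize_supported : supported (fun m => (mdeg m < (e - l).+1)%N) (P l).
    apply: supP => m [_ _ dm] mi; rewrite ltnS.
    have le : (U_(i) *+ l <= m)%MM.
      apply/mnm_lepP => j; rewrite mulmnE mnm1E.
      by case: eqVneq => [<-|//]; rewrite mi mul1n.
    have := congr1 mdeg (submK le); rewrite mdegD mdegMn mdeg1 dm; lia.
  by have := ltn_ord l; lia.
suff -> : 'X_i ^+ e + \sum_(l < e) P l * 'X_i ^+ l = g by [].
rewrite [RHS]mpolyE (bigD1_seq nu) ?msupp_uniq //= g1 scale1r mpolyXn; congr (_ + _).
apply/esym; rewrite big_seq_cond.
transitivity (\sum_(m <- msupp g | (m \in msupp g) && (m != nu))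
   \sum_(l < e | m i == l :> nat) g@_m *: 'X_[m]).
  apply: eq_bigr => m /andP[mg /(below _ mg)[mi _ _]].
  by rewrite (big_pred1 (Ordinal mi)) // => l; rewrite -val_eqE eq_sym.
rewrite (exchange_big_dep xpredT) //=; apply: eq_bigr => l _.
rewrite mulr_suml; apply: eq_big => [m|m /andP[_ /eqP mi]]; first by rewrite andbA.
rewrite -scalerAl mpolyXn -mpolyXD submK //.
apply/mnm_lepP => j; rewrite mulmnE mnm1E.
by case: eqVneq => [<-|//]; rewrite mi mul1n.
Qed.

End Lexicographic.

Theorem corollary4p1 (k : fieldType) (n : nat) (I : idealr {mpoly k[n]})
    (prec : rel 'X_{1..n}) (H : seq {mpoly k[n]}) (D : nat)
    (I_neq0 : exists2 f, f \in I & f != 0)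
    (I_homog : homog_ideal I)
    (prec_to : term_order prec)
    (H_pommaret : pommaret_basis prec I H)
    (H_homog : forall h, h \in H -> h \is homog mdeg)
    (dimA : krull_dim {ideal_quot I} D) :
  noether_normalisation D I /\
  (prec =2 @lex_lt n \/ prec =2 @deglex_lt n ->
   general_noether_normalisation D I).
Proof.
have [|D' [D'n powers tails]] := quasi_stable_dim prec_to H_pommaret.
  by have [f fI f0] := I_neq0; exists (lead_exp prec f), f.
have norm := noether_normal prec_to I_homog powers tails.
(* The Krull dimension is at least D' by the lifted chain and at most D' by the growth bound. *)
have DE : D = D'.
  have [[p chain] maxD] := dimA; have [p' chain'] := prime_chain_exists D'n norm.
  apply/eqP; rewrite eqn_leq (maxD _ _ chain') andbT.
  exact: (prime_chain_length prec_to I_homog D'n powers chain).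
rewrite {}DE in dimA *; split=> // precE; split=> // i /powers Lnu.
have [g [gI g1 supg]] := lead_exps_homog prec_to I_homog Lnu.
exists (cone_bound prec H); apply: (monic_equation gI g1) => m /supg[|[lt]]; first by left.
rewrite mdegMn mdeg1 mul1n => dm; right; apply: lex_lt_power (dm).
move: lt; case: precE => -> //.
(* Both exponents have the same degree, where the degree lexicographic order is the lexicographic
   one. *)
by rewrite /deglex_lt mdegMn mdeg1 mul1n dm ltnn eqxx.
Qed.
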